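(* Let $f:\mathbb{Z}_2 \to \mathbb{Z}_2$ be a 1-Lipschitz function with Mahler coefficients $(a_n)_{n\ge 0}$. Then $f$ is uniformly differentiable modulo $2$ with $N_1(f) = 1$ if and only if for every integer $s \geq 2$ and every integer $n$ with $2^s \leq n < 2^{s+1}$ one has $a_n \equiv 0 \pmod{2^{s+1}}$.
   Context: A function $f:\mathbb{Z}_p\to\mathbb{Z}_p$ is 1-Lipschitz if $|f(x)-f(y)|_p \le |x-y|_p$ for all $x,y\in\mathbb{Z}_p$. The Mahler coefficients of a continuous $f$ are $a_n = \sum_{i=0}^{n}(-1)^{n-i}\binom{n}{i} f(i)$, so that $f(x)=\sum_{n\ge0} a_n\binom{x}{n}$. A function $f:\mathbb{Z}_p\to\mathbb{Z}_p$ is uniformly differentiable modulo $p^k$ if there exist a positive integer $N$ and, for each $u\in\mathbb{Z}_p$, an element $\partial_k f(u)\in\mathbb{Q}_p$ (independent of $s$ and $h$) such that for every integer $s\ge N$, every $u\in\mathbb{Z}_p$ and every $h\in\mathbb{Z}_p$, $f(u+p^s h)\equiv f(u)+p^s h\,\partial_k f(u) \pmod{p^{k+s}}$; the smallest such $N$ is denoted $N_k(f)$. Here $p=2$, $k=1$. *)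

(* Defs.v *)
From HB Require Import structures.
From mathcomp Require Import all_boot all_order all_algebra.
From mathcomp Require Import boolp.

Set Implicit Arguments.
Unset Strict Implicit.
Unset Printing Implicit Defensive.

Import Order.TTheory GRing.Theory Num.Theory.

Local Open Scope ring_scope.

Lemma modz_mod_dvd (d e a : int) :
  (d %| e)%Z -> ((a %% e)%Z = a %[mod d])%Z.
Proof.
by move=> /dvdzP[c ->]; rewrite [in RHS](divz_eq a (c * d)) mulrA modzMDl.
Qed.

(* The ring Z_p, as the inverse limit of the rings Z/p^n: the residue modulo
   p^n is represented by its least nonnegative representative
   (coherence forces 0 <= padic_res x n < p^n).  The unused primality argument
   lets the integral domain instance be inferred from the type. *)
Record padic_int (p : nat) (p_pr : prime p) := PadicInt {
  padic_res :> nat -> int;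
  padic_resP : forall n, padic_res n = (padic_res n.+1 %% p%:Z ^+ n)%Z
}.

Section PadicIntRing.
Variables (p : nat) (p_pr : prime p).
Local Notation Zp := (padic_int p_pr).

HB.instance Definition _ := gen_eqMixin Zp.
HB.instance Definition _ := gen_choiceMixin Zp.

Lemma padic_ext (x y : Zp) : (forall n, x n = y n) -> x = y.
Proof.
case: x y => [x xP] [y yP] /= /funext exy; case: _ / exy yP => yP.
by congr PadicInt; exact: Prop_irrelevance.
Qed.

Lemma padic_res_mod (x : Zp) n : (x n %% p%:Z ^+ n)%Z = x n.
Proof. by rewrite padic_resP modz_mod. Qed.

Lemma padic_res_next (x : Zp) n : (x n.+1 = x n %[mod p%:Z ^+ n])%Z.
Proof. by rewrite padic_res_mod -padic_resP. Qed.

Lemma padic_mk_subproof (a : nat -> int) :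
  (forall n, (a n.+1 = a n %[mod p%:Z ^+ n])%Z) ->
  forall n, (a n %% p%:Z ^+ n)%Z = ((a n.+1 %% p%:Z ^+ n.+1)%Z %% p%:Z ^+ n)%Z.
Proof.
by move=> aP n; rewrite -aP modz_mod_dvd // exprS dvdz_mull.
Qed.

Definition padic_mk a aP : Zp := PadicInt p_pr (@padic_mk_subproof a aP).

Fact padic_zero_subproof n : (0 = 0 %[mod p%:Z ^+ n])%Z. Proof. by []. Qed.

Fact padic_one_subproof n : (1 = 1 %[mod p%:Z ^+ n])%Z. Proof. by []. Qed.

Fact padic_opp_subproof (x : Zp) n : (- x n.+1 = - x n %[mod p%:Z ^+ n])%Z.
Proof. by rewrite -modzNm padic_res_next modzNm. Qed.

Fact padic_add_subproof (x y : Zp) n :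
  (x n.+1 + y n.+1 = x n + y n %[mod p%:Z ^+ n])%Z.
Proof. by rewrite -modzDm !padic_res_next modzDm. Qed.

Fact padic_mul_subproof (x y : Zp) n :
  (x n.+1 * y n.+1 = x n * y n %[mod p%:Z ^+ n])%Z.
Proof. by rewrite -modzMm !padic_res_next modzMm. Qed.

Definition padic_zero : Zp := padic_mk padic_zero_subproof.
Definition padic_one : Zp := padic_mk padic_one_subproof.
Definition padic_opp (x : Zp) : Zp := padic_mk (padic_opp_subproof x).
Definition padic_add (x y : Zp) : Zp := padic_mk (padic_add_subproof x y).
Definition padic_mul (x y : Zp) : Zp := padic_mk (padic_mul_subproof x y).

Fact padic_addA : associative padic_add.
Proof.
by move=> x y z; apply: padic_ext => n /=; rewrite modzDmr modzDml addrA.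
Qed.

Fact padic_addC : commutative padic_add.
Proof. by move=> x y; apply: padic_ext => n /=; rewrite addrC. Qed.

Fact padic_add0 : left_id padic_zero padic_add.
Proof.
by move=> x; apply: padic_ext => n /=; rewrite mod0z add0r padic_res_mod.
Qed.

Fact padic_addN : left_inverse padic_zero padic_opp padic_add.
Proof. by move=> x; apply: padic_ext => n /=; rewrite modzDml addNr. Qed.

HB.instance Definition _ := GRing.isZmodule.Build Zp
  padic_addA padic_addC padic_add0 padic_addN.

Fact padic_mulA : associative padic_mul.
Proof.
by move=> x y z; apply: padic_ext => n /=; rewrite modzMmr modzMml mulrA.
Qed.

Fact padic_mulC : commutative padic_mul.
Proof. by move=> x y; apply: padic_ext => n /=; rewrite mulrC. Qed.

Fact padic_mul1 : left_id padic_one padic_mul.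
Proof.
by move=> x; apply: padic_ext => n /=; rewrite modzMml mul1r padic_res_mod.
Qed.

Fact padic_mulD : left_distributive padic_mul padic_add.
Proof.
by move=> x y z; apply: padic_ext => n /=; rewrite modzMml modzDm mulrDl.
Qed.

Fact padic_one_neq0 : padic_one != 0.
Proof.
apply/eqP => /(congr1 (fun x : Zp => x 1)) /=; rewrite expr1 mod0z.
by rewrite modz_small // lez_nat ltz_nat prime_gt1.
Qed.

HB.instance Definition _ := GRing.Zmodule_isComNzRing.Build Zp
  padic_mulA padic_mulC padic_mul1 padic_mulD padic_one_neq0.

Definition padic_unit : {pred Zp} := [pred x | `[< exists y, y * x = 1 >]].

Definition padic_inv (x : Zp) : Zp :=
  if pselect (exists y, y * x = 1) is left h then projT1 (cid h) else x.

Fact padic_mulV : {in padic_unit, left_inverse 1 padic_inv *%R}.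
Proof.
by move=> x /asboolP ux; rewrite /padic_inv; case: pselect => // h; case: cid.
Qed.

Fact padic_unitP (x y : Zp) : y * x = 1 -> padic_unit x.
Proof. by move=> yx1; apply/asboolP; exists y. Qed.

Fact padic_inv_out : {in [predC padic_unit], padic_inv =1 id}.
Proof.
by move=> x /asboolP nux; rewrite /padic_inv; case: pselect.
Qed.

HB.instance Definition _ := GRing.ComNzRing_hasMulInverse.Build Zp
  padic_mulV padic_unitP padic_inv_out.

Lemma padic_res_le (x : Zp) m n :
  (m <= n)%N -> x m = (x n %% p%:Z ^+ m)%Z.
Proof.
move=> /subnKC <-; elim: (n - m)%N => [|k IHk].
  by rewrite addn0 padic_res_mod.
by rewrite IHk addnS (padic_resP x (m + k)) modz_mod_dvd // exprD dvdz_mulr.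
Qed.

Lemma padic_neq0P (x : Zp) : x != 0 -> exists n, x n.+1 != 0.
Proof.
move=> x0; apply: contrapT => nx; move/eqP: x0; apply.
apply: padic_ext => n /=; rewrite mod0z padic_resP.
by have [-> | xn] := eqVneq (x n.+1) 0; [rewrite mod0z | case: nx; exists n].
Qed.

Fact padic_integral : GRing.integral_domain_axiom Zp.
Proof.
move=> x y xy0; apply/norP => -[].
move=> /padic_neq0P[m xm] /padic_neq0P[n yn].
have resN0 (z : Zp) k l : (k <= l)%N -> z k != 0 -> ~~ (p ^ k %| `|z l|)%N.
  move=> kl; apply: contra => dv; rewrite (padic_res_le z kl).
  by apply/eqP/dvdz_mod0P; rewrite dvdzE abszX.
have: (x * y) (m.+1 + n.+1)%N = 0 by rewrite xy0 /= mod0z.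
have {}xm := resN0 x _ _ (leq_addr n.+1 m.+1) xm.
have {}yn := resN0 y _ _ (leq_addl m.+1 n.+1) yn.
have pos (a k : nat) : ~~ (p ^ k %| a)%N -> (0 < a)%N.
  by case: a => //; rewrite dvdn0.
have a0 := pos _ _ xm; have b0 := pos _ _ yn.
move=> /= /dvdz_mod0P; rewrite dvdzE abszX abszM /=.
rewrite pfactor_dvdn ?muln_gt0 ?a0 // lognM //.
move: xm yn; rewrite !pfactor_dvdn // -!ltnNge => lx ly.
by apply/negP; rewrite -ltnNge addSn ltnS leq_add // ltnW.
Qed.

HB.instance Definition _ := GRing.ComUnitRing_isIntegral.Build Zp
  padic_integral.

End PadicIntRing.

Section UniformDifferentiability.
Variables (p : nat) (p_pr : prime p).
Local Notation Zp := (padic_int p_pr).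
Local Notation Qp := {fraction Zp}.

(* |x|_p = p^-v, where v is the largest exponent with x = 0 in Z/p^v. *)
Definition padic_norm (x : Zp) : rat :=
  if pselect (exists n, x n.+1 != 0) is left h then p%:R ^- ex_minn h else 0.

Definition one_lipschitz (f : Zp -> Zp) :=
  forall x y, padic_norm (f x - f y) <= padic_norm (x - y).

Definition mahler_coef (f : Zp -> Zp) (n : nat) : Zp :=
  \sum_(i < n.+1) (-1) ^+ (n - i) * 'C(n, i)%:R * f i%:R.

Definition eq_mod_Zp (m : nat) (x y : Zp) :=
  exists c : Zp, x - y = p%:R ^+ m * c.

Definition eq_mod_Qp (m : nat) (x y : Qp) :=
  exists c : Zp, x - y = p%:R ^+ m * tofrac c.

Definition unif_diff_from (k : nat) (f : Zp -> Zp) (N : nat) :=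
  (0 < N)%N /\
  exists df : Zp -> Qp, forall (s : nat) (u h : Zp), (N <= s)%N ->
    eq_mod_Qp (k + s) (tofrac (f (u + p%:R ^+ s * h)))
                      (tofrac (f u) + p%:R ^+ s * tofrac h * df u).

Definition unif_diff_mod (k : nat) (f : Zp -> Zp) :=
  exists N, unif_diff_from k f N.

Fact unif_diff_mod_asbool k f :
  unif_diff_mod k f -> exists N, `[< unif_diff_from k f N >].
Proof. by case=> N fN; exists N; apply/asboolP. Qed.

(* The invariant N_k(f); the value 0 when f is not uniformly differentiable
   modulo p^k is junk. *)
Definition unif_diff_index (k : nat) (f : Zp -> Zp) : nat :=
  if pselect (unif_diff_mod k f) is left h
  then ex_minn (unif_diff_mod_asbool h) else 0%N.

End UniformDifferentiability.

Definition prime2 : prime 2 := isT.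

(* Main.v *)
(** Let L be the linear functional on Z_2[X] with L(X^i) = f(i), so that the
    n-th Mahler coefficient is L((X-1)^n), and let Ann_m be the ideal of those P
    with 2^m | L(QP) for all Q.  Put y_s = X^(2^s) - 1.  The Lipschitz condition
    gives y_s in Ann_s.  Comparing the difference quotients at scales 2^s and
    2^(s+1), differentiability modulo 2 with N_1 = 1 amounts to
    f(u+2^(s+1)) - 2f(u+2^s) + f(u) being divisible by 2^(s+2) for s >= 1, that
    is, to y_s^2 in Ann_(s+2).  Since the powers of X-1 are a basis, the
    condition on the coefficients amounts to (X-1)^(2^s) in Ann_(s+1) for s >= 2.
    Finally y_(s+1) = y_s^2 + 2y_s shows inductively that (X-1)^(2^(s+1)) and
    y_s^2 agree modulo Ann_(s+2), so both conditions coincide. *)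
Require Import Defs.
From HB Require Import structures.
From mathcomp Require Import all_boot all_order all_algebra.
From mathcomp Require Import boolp ring.
Import Order.TTheory GRing.Theory Num.Theory.

Local Open Scope ring_scope.

(** * Divisibility by powers of 2 in a commutative ring *)

Section Pow2Dvd.
Variable R : comNzRingType.

Definition pow2_dvd (m : nat) (x : R) := exists c, x = 2%:R ^+ m * c.

Lemma pow2_dvd0 m : pow2_dvd m 0.
Proof. by exists 0; rewrite mulr0. Qed.

Lemma pow2_dvdD m x y : pow2_dvd m x -> pow2_dvd m y -> pow2_dvd m (x + y).
Proof. by move=> [a ->] [b ->]; exists (a + b); rewrite mulrDr. Qed.

Lemma pow2_dvdMl m a x : pow2_dvd m x -> pow2_dvd m (a * x).
Proof. by move=> [b ->]; exists (a * b); rewrite mulrCA. Qed.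

Lemma pow2_dvdN m x : pow2_dvd m x -> pow2_dvd m (- x).
Proof. by rewrite -mulN1r; apply: pow2_dvdMl. Qed.

Lemma pow2_dvd_double m x : pow2_dvd m x -> pow2_dvd m.+1 (2%:R * x).
Proof. by move=> [a ->]; exists a; rewrite exprS mulrA. Qed.

Lemma pow2_dvd_le m n x : (m <= n)%N -> pow2_dvd n x -> pow2_dvd m x.
Proof.
move=> /subnKC <- [a ->]; exists (2%:R ^+ (n - m) * a).
by rewrite exprD mulrA.
Qed.

End Pow2Dvd.

(** * The functional L and the ideals Ann_m *)

Section Umbral.
Variables (R : comNzRingType) (f : nat -> R).
Implicit Types P Q : {poly R}.

Definition umbral P : R := \sum_(i < size P) P`_i * f i.

Lemma umbral_widen n P :
  (size P <= n)%N -> umbral P = \sum_(i < n) P`_i * f i.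
Proof.
move=> Pn; rewrite /umbral (big_ord_widen n (fun i => P`_i * f i) Pn).
rewrite big_mkcond /=; apply: eq_bigr => i _.
by case: ltnP => // /(nth_default 0) ->; rewrite mul0r.
Qed.

Fact umbral_is_linear : linear_for *%R umbral.
Proof.
move=> a P Q; pose n := maxn (size P) (size Q).
have sP : (size P <= n)%N by apply: leq_maxl.
have sQ : (size Q <= n)%N by apply: leq_maxr.
have sPQ : (size (a *: P + Q)%R <= n)%N.
  apply: leq_trans (size_polyD _ _) _; rewrite geq_max sQ andbT.
  exact: leq_trans (size_scale_leq _ _) sP.
rewrite (umbral_widen n P) // (umbral_widen n Q) // (umbral_widen n) //.
rewrite mulr_sumr -big_split /=; apply: eq_bigr => i _.
by rewrite coefD coefZ mulrDl mulrA.
Qed.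

HB.instance Definition _ :=
  GRing.isLinear.Build R {poly R} R *%R umbral umbral_is_linear.

Lemma umbralXn n : umbral 'X^n = f n.
Proof.
rewrite (umbral_widen n.+1) ?size_polyXn // (bigD1 ord_max) //=.
rewrite coefXn eqxx mul1r big1 ?addr0 // => i.
by rewrite coefXn -val_eqE /= => /negPf ->; rewrite mul0r.
Qed.

Lemma umbral_subX1 n :
  umbral (('X - 1) ^+ n) =
    \sum_(i < n.+1) (-1) ^+ (n - i) * 'C(n, i)%:R * f i.
Proof.
rewrite addrC exprDn linear_sum /=; apply: eq_bigr => i _.
have -> : (-1) ^+ (n - i) * 'X^i *+ 'C(n, i) =
    ((-1) ^+ (n - i) * 'C(n, i)%:R) *: 'X^i :> {poly R}.
  by rewrite -mul_polyC polyCM polyC_exp polyCN polyC_natr -mulr_natr mulrAC.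
by rewrite linearZ /= umbralXn.
Qed.

(** Testing every multiple of P makes this an ideal, although L is only linear. *)
Definition umbral_ann m P := forall Q, pow2_dvd R m (umbral (Q * P)).

Lemma umbral_annD m P Q :
  umbral_ann m P -> umbral_ann m Q -> umbral_ann m (P + Q).
Proof.
by move=> hP hQ S; rewrite mulrDr linearD; exact: pow2_dvdD.
Qed.

Lemma umbral_annMl m P Q : umbral_ann m Q -> umbral_ann m (P * Q).
Proof. by move=> hQ S; rewrite mulrA. Qed.

Lemma umbral_annN m P : umbral_ann m P -> umbral_ann m (- P).
Proof. by rewrite -mulN1r; apply: umbral_annMl. Qed.

Lemma umbral_ann_double m P : umbral_ann m P -> umbral_ann m.+1 (2%:R * P).
Proof.
move=> hP S; rewrite mulrCA mulr_natl linearMn -mulr_natl.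
exact: pow2_dvd_double.
Qed.

(** By linearity of L, multipliers from a spanning family suffice: powers of X give differences of
    values of f, powers of X-1 give Mahler coefficients. *)
Lemma umbral_ann_span m P (b : nat -> {poly R}) :
  (forall Q, exists (n : nat) (c : nat -> R), Q = \sum_(i < n) c i *: b i) ->
  (forall i, pow2_dvd R m (umbral (b i * P))) -> umbral_ann m P.
Proof.
move=> spanb hb Q; have [n [c ->]] := spanb Q.
rewrite mulr_suml linear_sum /=.
elim/big_ind: _ => [||i _]; [exact: pow2_dvd0 | exact: pow2_dvdD |].
by rewrite -scalerAl linearZ; apply: pow2_dvdMl.
Qed.

Lemma umbral_ann_Xn m P :
  (forall u, pow2_dvd R m (umbral ('X^u * P))) -> umbral_ann m P.
Proof.
apply: umbral_ann_span => Q; exists (size Q), (nth 0 Q).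
by rewrite -poly_def coefK.
Qed.

Lemma umbral_ann_subX1 m P :
  (forall k, pow2_dvd R m (umbral (('X - 1) ^+ k * P))) -> umbral_ann m P.
Proof.
apply: umbral_ann_span => Q.
(* The coordinates of Q in the powers of X-1 are the coefficients of Q(X+1). *)
exists (size (Q \Po ('X + 1))), (nth 0 (Q \Po ('X + 1))).
rewrite -comp_polyE -comp_polyA comp_polyD comp_polyX comp_polyC.
by rewrite subrK comp_polyXr.
Qed.

Lemma umbral_shift_diff u n :
  umbral ('X^u * ('X^n - 1)) = f (u + n)%N - f u.
Proof. by rewrite mulrBr mulr1 -exprD linearB /= !umbralXn. Qed.

Lemma umbral_shift_diff2 u s :
  umbral ('X^u * ('X^(2 ^ s) - 1) ^+ 2) =
    f (u + 2 ^ s.+1)%N - f u - 2%:R * (f (u + 2 ^ s)%N - f u).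
Proof.
have -> : 'X^u * ('X^(2 ^ s) - 1) ^+ 2 =
    'X^u * ('X^(2 ^ s.+1) - 1) - ('X^u * ('X^(2 ^ s) - 1)) *+ 2 :> {poly R}.
  rewrite expnSr exprM; ring.
by rewrite linearB linearMn /= !umbral_shift_diff mulr_natl.
Qed.

(** * Comparing powers of X-1 with the squares of the y_s *)

Section Congruences.
Hypothesis lip_f : forall s, umbral_ann s ('X^(2 ^ s) - 1).

(** The form 2b of the remainder makes the induction close: its square b(2(2b)) gains a factor 2.
    Assuming only t < s lets the lemma serve in a strong induction on s. *)
Lemma subX1_pow2_remainder s :
  (forall t, (t < s)%N -> umbral_ann t.+3 (('X^(2 ^ t.+1) - 1) ^+ 2)) ->
  exists b : {poly R},
    ('X - 1) ^+ (2 ^ s.+2) = ('X^(2 ^ s.+1) - 1) ^+ 2 + 2%:R * b /\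
    umbral_ann s.+3 (2%:R * b).
Proof.
elim: s => [_|s IHs ann_sq].
  exists (2%:R * (- ('X - 1)) * ('X^2 - 1) + 2%:R * ('X - 1) ^+ 2).
  split; first by rewrite !expnS expn0 muln1; ring.
  (* As (X-1)^2 = (X^2-1) - 2(X-1), this reduces to y_1 in Ann_1 and y_0 in Ann_0. *)
  have -> : 2%:R * (2%:R * (- ('X - 1)) * ('X^2 - 1) + 2%:R * ('X - 1) ^+ 2) =
    (- 'X + 2%:R) * (2%:R * (2%:R * ('X^2 - 1)))
    + - (2%:R * (2%:R * (2%:R * ('X^1 - 1)))) :> {poly R} by ring.
  apply: umbral_annD; [apply: umbral_annMl | apply: umbral_annN];
    do 2!apply: umbral_ann_double; [exact: (lip_f 1) |].
  exact/umbral_ann_double/(lip_f 0).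
have [t ts|b [def_b ann_b]] := IHs; first by apply: ann_sq; apply: ltnW.
have ann_y := ann_sq s (ltnSn s); have ann_z := lip_f s.+2.
set y := 'X^(2 ^ s.+1) - 1 in def_b ann_y; set z := _ - 1 in ann_z *.
have def_z : z = y ^+ 2 + 2%:R * y.
  rewrite /z /y expnSr exprM; ring.
(* Square y^2 + 2b and substitute y^4 = z^2 - 4zy + 4y^2. *)
exists (- (2%:R * (z * y)) + 2%:R * y ^+ 2 + 2%:R * (b * y ^+ 2) +
        2%:R * b ^+ 2); split.
  rewrite expnSr exprM def_b def_z; ring.
have -> : 2%:R * (- (2%:R * (z * y)) + 2%:R * y ^+ 2 + 2%:R * (b * y ^+ 2) +
        2%:R * b ^+ 2) =
   - y * (2%:R * (2%:R * z)) + (2%:R * (1 + b)) * (2%:R * y ^+ 2) +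
   b * (2%:R * (2%:R * b)) by ring.
do 2?apply: umbral_annD; apply: umbral_annMl; apply: umbral_ann_double => //.
exact: umbral_ann_double.
Qed.

Lemma umbral_ann_sq_iff :
  (forall s, umbral_ann s.+3 (('X^(2 ^ s.+1) - 1) ^+ 2)) <->
  (forall s, umbral_ann s.+3 (('X - 1) ^+ (2 ^ s.+2))).
Proof.
split=> [ann_sq s | ann_pow s].
  have [t _|b [-> ann_b]] := subX1_pow2_remainder s; first exact: ann_sq.
  exact: umbral_annD.
elim/ltn_ind: s => s IHs; have [b [def_b ann_b]] := subX1_pow2_remainder s IHs.
by rewrite -[_ ^+ 2](addrK (2%:R * b)) -def_b; apply/umbral_annD/umbral_annN.
Qed.

End Congruences.

(** Multiplying (X-1)^(2^(s+2)) by powers of X-1 gives all (X-1)^n with n >= 2^(s+2); such an n lies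
    in a dyadic block of exponent at least s+2, whose condition is at least as strong. *)
Lemma umbral_ann_subX1_pow2_iff :
  (forall s, umbral_ann s.+3 (('X - 1) ^+ (2 ^ s.+2))) <->
  (forall s n, (2 <= s)%N -> (2 ^ s <= n < 2 ^ s.+1)%N ->
     pow2_dvd R s.+1 (umbral (('X - 1) ^+ n))).
Proof.
split=> [ann_pow [|[|s]] // n _ /andP[/subnK <- _]|coefs s].
  by rewrite exprD; apply: ann_pow.
apply: umbral_ann_subX1 => k; rewrite -exprD.
have n_ge : (2 ^ s.+2 <= k + 2 ^ s.+2)%N by apply: leq_addl.
move: (k + _)%N n_ge => n n_ge.
have n_gt0 : (0 < n)%N by apply: leq_trans n_ge; rewrite expn_gt0.
have s_le : (s.+2 <= trunc_log 2 n)%N by apply: trunc_log_max.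
apply: (@pow2_dvd_le _ _ (trunc_log 2 n).+1) => //.
apply: coefs; first exact: leq_trans s_le.
by apply: trunc_log_bounds.
Qed.

End Umbral.

(** Admissible thresholds are positive, so the least one is 1 exactly when 1 is admissible. *)
Lemma unif_diff_index1 (p : nat) (p_pr : prime p) k
    (f : padic_int p_pr -> padic_int p_pr) :
  (unif_diff_mod k f /\ unif_diff_index k f = 1%N) <-> unif_diff_from k f 1.
Proof.
rewrite /unif_diff_index; split=> [[fP]|f1].
  by case: pselect => // h; case: ex_minnP => N /asboolP fN _ N1; subst N.
have fP : unif_diff_mod k f by exists 1%N.
split=> //; case: pselect => // h; case: ex_minnP => N /asboolP[N0 _] minN.
by apply/eqP; rewrite eqn_leq N0 andbT; apply/minN/asboolP.
Qed.

(** * Divisibility and approximation in Z_2 *)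

Section DyadicIntegers.
Local Notation Z2 := (padic_int prime2).
Implicit Types x y u h : Z2.

Lemma padic_res_nat (n m : nat) : (n%:R : Z2) m = (n%:Z %% 2%:Z ^+ m)%Z.
Proof.
elim: n => [|n IHn] /=; first by rewrite mod0z.
by rewrite mulrSr intS addrC /= IHn modzDm.
Qed.

Lemma padic_res_pow2 m n :
  (2%:R ^+ m : Z2) n = (2%:Z ^+ m %% 2%:Z ^+ n)%Z.
Proof.
rewrite -natrX padic_res_nat; congr (_ %% _)%Z.
by rewrite -natz natrX.
Qed.

Lemma padic_res0P x m : x m = 0 <-> pow2_dvd Z2 m x.
Proof.
split=> [xm0 | [c ->]]; last first.
  rewrite [LHS]/= padic_res_pow2 modzMml.
  by rewrite modzMr.
have dvd_x n : (2%:Z ^+ m %| x (n + m)%N)%Z.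
  by apply/dvdz_mod0P; rewrite -padic_res_le ?leq_addl.
have pow_neq0 n : 2%:Z ^+ n != 0 by rewrite expf_neq0.
(* Dividing by 2^m costs m digits: the quotient modulo 2^n is read off x modulo 2^(n+m). *)
have quotP n : ((x (n.+1 + m)%N %/ 2%:Z ^+ m)%Z =
    (x (n + m)%N %/ 2%:Z ^+ m)%Z %[mod 2%:Z ^+ n])%Z.
  apply/eqP; rewrite eqz_mod_dvd -(dvdz_mul2r (p := 2%:Z ^+ m)) ?pow_neq0 //.
  rewrite mulrBl !divzK // -exprD -eqz_mod_dvd; apply/eqP.
  exact: padic_res_next.
exists (padic_mk prime2 quotP); apply: padic_ext => n.
rewrite [RHS]/= padic_res_pow2 modzMm mulrC divzK //.
by rewrite -padic_res_le // leq_addr.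
Qed.

(** If x were nonzero modulo 2^m, its valuation would be below m, and the norm inequality would
    force that of y below m too. *)
Lemma pow2_dvd_norm_le x y m :
  padic_norm x <= padic_norm y -> pow2_dvd Z2 m y -> pow2_dvd Z2 m x.
Proof.
rewrite -!padic_res0P /padic_norm; case: m => [|m] xy ym0.
  by rewrite padic_resP expr0 modz1.
apply: contrapT => /eqP xm; move: xy.
case: pselect => [ex|[]]; last by exists m.
case: ex_minnP => i _ /(_ m xm) im.
have inv_gt0 k : 0 < (2%:R : rat) ^- k by rewrite invr_gt0 exprn_gt0.
case: pselect => [ey|_]; last by rewrite leNgt inv_gt0.
case: ex_minnP => j yj _.
rewrite lef_pV2 ?posrE ?exprn_gt0 // ler_eXn2l ?ltr1n // => ji.
case/eqP: yj; rewrite (@padic_res_le _ _ _ j.+1 m.+1) ?ym0 ?mod0z //.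
exact: leq_trans im.
Qed.

Lemma padic_nat_approx x m :
  exists n : nat, pow2_dvd Z2 m (x - n%:R).
Proof.
exists `|x m|%N; apply/padic_res0P; rewrite /= padic_res_nat.
rewrite gez0_abs; last by rewrite padic_resP modz_ge0 // expf_neq0.
by rewrite padic_res_mod modzDmr subrr mod0z.
Qed.

Lemma padic_parity x : exists k : Z2, x = 2%:R * k \/ x = 1 + 2%:R * k.
Proof.
have [n [c xn]] := padic_nat_approx x 1.
have -> : x = (odd n)%:R + 2%:R * ((n./2)%:R + c).
  rewrite mulrDr addrA -natrM mul2n -natrD odd_double_half.
  by rewrite -[LHS](subrK n%:R) xn expr1 addrC.
exists ((n./2)%:R + c).
by case: (odd n); [right | left; rewrite add0r].
Qed.

Lemma padic_two_neq0 : 2%:R != 0 :> Z2.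
Proof.
(* Residues modulo 4 are compared, since 2 vanishes modulo 2. *)
apply/eqP => /(congr1 (fun x : Z2 => x 2)).
by rewrite padic_res_nat /= mod0z.
Qed.

(** * Differentiability modulo 2 as a second-difference condition *)

Section Lipschitz.
Variables (f : Z2 -> Z2) (lip_f : one_lipschitz f).

Lemma lipschitz_pow2_dvd m x y :
  pow2_dvd Z2 m (x - y) -> pow2_dvd Z2 m (f x - f y).
Proof. exact: pow2_dvd_norm_le. Qed.

Lemma lipschitz_pow2_shift s u h : pow2_dvd Z2 s (f (u + 2%:R ^+ s * h) - f u).
Proof. by apply: lipschitz_pow2_dvd; exists h; rewrite addrC addKr. Qed.

Lemma lipschitz_umbral_ann s :
  umbral_ann Z2 (fun n => f n%:R) s ('X^(2 ^ s) - 1).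
Proof.
apply: umbral_ann_Xn => u; rewrite umbral_shift_diff natrD natrX.
by rewrite -[X in u%:R + X]mulr1; apply: lipschitz_pow2_shift.
Qed.

Definition second_diff_cond :=
  forall s u, pow2_dvd Z2 s.+3
    (f (u + 2%:R ^+ s.+2) - f u - 2%:R * (f (u + 2%:R ^+ s.+1) - f u)).

(** The left side only sees natural u. Replacing a 2-adic u by a natural number congruent modulo
    2^(s+3) changes each value of f by a multiple of 2^(s+3). *)
Lemma umbral_ann_second_diff_iff :
  (forall s, umbral_ann Z2 (fun n => f n%:R) s.+3 (('X^(2 ^ s.+1) - 1) ^+ 2))
  <-> second_diff_cond.
Proof.
split=> [ann_sq s u | diff2 s]; last first.
  apply: umbral_ann_Xn => u; rewrite umbral_shift_diff2 ![(u + _)%:R]natrD !natrX.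
  exact: diff2.
have [n un] := padic_nat_approx u s.+3.
have := ann_sq s 'X^n; rewrite umbral_shift_diff2 ![(n + _)%:R]natrD !natrX => diff2_n.
have approx h : pow2_dvd Z2 s.+3 (f (u + h) - f (n%:R + h)).
  by apply: lipschitz_pow2_dvd; rewrite opprD addrACA subrr addr0.
have := approx 0; rewrite !addr0 => approx0.
have -> : f (u + 2%:R ^+ s.+2) - f u - 2%:R * (f (u + 2%:R ^+ s.+1) - f u) =
  (f (n%:R + 2%:R ^+ s.+2) - f n%:R - 2%:R * (f (n%:R + 2%:R ^+ s.+1) - f n%:R))
  + ((f (u + 2%:R ^+ s.+2) - f (n%:R + 2%:R ^+ s.+2))
  + ((f u - f n%:R)
  + - 2%:R * (f (u + 2%:R ^+ s.+1) - f (n%:R + 2%:R ^+ s.+1)))) by ring.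
do 3![apply: pow2_dvdD => //]; exact: pow2_dvdMl.
Qed.

Lemma unif_diff_second_diff : unif_diff_from 1 f 1 -> second_diff_cond.
Proof.
case=> _ [df dfP] s u.
have [c1] := dfP s.+1 u 1 isT; have [c2] := dfP s.+2 u 1 isT.
rewrite !rmorph1 !mulr1 => e2 e1.
(* The derivative terms at scales 2^(s+2) and 2^(s+1) cancel, leaving the errors 2^(s+3) c2 and 2 *
   2^(s+2) c1. *)
exists (c2 - c1); apply/eqP; rewrite -tofrac_eq; apply/eqP.
rewrite !(tofracB, tofracXn, tofracM, rmorph_nat).
have {}e2 := canRL (subrK _) e2; have {}e1 := canRL (subrK _) e1.
rewrite e2 e1 !add1n !exprS. ring.
Qed.

(** Each doubling of the step doubles the increment up to a second difference, so all scales are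
    compared with step 2. *)
Lemma second_diff_shift1 s u : second_diff_cond ->
  pow2_dvd Z2 s.+2
    (f (u + 2%:R ^+ s.+1) - f u - 2%:R ^+ s * (f (u + 2%:R) - f u)).
Proof.
move=> diff2; elim: s => [|s IHs].
  by rewrite expr0 mul1r expr1 subrr; apply: pow2_dvd0.
have -> : f (u + 2%:R ^+ s.+2) - f u - 2%:R ^+ s.+1 * (f (u + 2%:R) - f u) =
  (f (u + 2%:R ^+ s.+2) - f u - 2%:R * (f (u + 2%:R ^+ s.+1) - f u)) +
  2%:R * (f (u + 2%:R ^+ s.+1) - f u - 2%:R ^+ s * (f (u + 2%:R) - f u)).
  by rewrite [_ ^+ s.+1 in LHS]exprS; ring.
by apply: pow2_dvdD => //; apply: pow2_dvd_double.
Qed.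

(** For even h both terms vanish modulo 2^(s+2) by the Lipschitz condition; for odd h the same
    argument removes the even part h - 1, leaving h = 1. *)
Lemma second_diff_shift s u h : second_diff_cond ->
  pow2_dvd Z2 s.+2
    (f (u + 2%:R ^+ s.+1 * h) - f u - 2%:R ^+ s * h * (f (u + 2%:R) - f u)).
Proof.
move=> diff2; set d := f (u + 2%:R) - f u.
have even_mult k : pow2_dvd Z2 s.+2 (2%:R ^+ s * (2%:R * k) * d).
  have [c dc] : pow2_dvd Z2 1 d.
    by have := lipschitz_pow2_shift 1 u 1; rewrite mulr1.
  by exists (k * c); rewrite dc !exprS; ring.
have [k [->|->]] := padic_parity h.
  apply: pow2_dvdD; last exact: pow2_dvdN.
  by rewrite mulrA -exprSr; apply: lipschitz_pow2_shift.
have -> : u + 2%:R ^+ s.+1 * (1 + 2%:R * k) =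
    u + 2%:R ^+ s.+1 + 2%:R ^+ s.+2 * k by rewrite !exprS; ring.
have -> : f (u + 2%:R ^+ s.+1 + 2%:R ^+ s.+2 * k) - f u -
      2%:R ^+ s * (1 + 2%:R * k) * d =
    (f (u + 2%:R ^+ s.+1 + 2%:R ^+ s.+2 * k) - f (u + 2%:R ^+ s.+1)) +
    ((f (u + 2%:R ^+ s.+1) - f u - 2%:R ^+ s * d) +
     - (2%:R ^+ s * (2%:R * k) * d)) by ring.
apply: pow2_dvdD; first exact: lipschitz_pow2_shift.
apply: pow2_dvdD; first exact: second_diff_shift1.
by apply: pow2_dvdN.
Qed.

Lemma second_diff_unif_diff : second_diff_cond -> unif_diff_from 1 f 1.
Proof.
move=> diff2; split=> //.
(* The difference quotient at the coarsest scale allowed, 2, serves as derivative. *)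
exists (fun u => tofrac (f (u + 2%:R) - f u) / 2%:R) => -[//|s] u h _.
have [c fc] := second_diff_shift s u h diff2; exists c.
have two_neq0 : 2%:R != 0 :> {fraction Z2}.
  by rewrite -(rmorph_nat (@tofrac Z2)) tofrac_eq0 padic_two_neq0.
have := congr1 (@tofrac Z2) fc.
rewrite add1n !(tofracB, tofracXn, tofracM, rmorph_nat).
move=> /(canRL (subrK _)) /(canRL (subrK _)) ->.
by rewrite [2%:R ^+ s.+1 in LHS]exprS; field.
Qed.

Lemma unif_diff_iff_second_diff : unif_diff_from 1 f 1 <-> second_diff_cond.
Proof.
by split; [exact: unif_diff_second_diff | exact: second_diff_unif_diff].
Qed.

End Lipschitz.

End DyadicIntegers.

Theorem theorem3p7 (f : padic_int prime2 -> padic_int prime2)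
    (hf : one_lipschitz f) :
  (unif_diff_mod 1 f /\ unif_diff_index 1 f = 1%N) <->
  (forall s n : nat, (2 <= s)%N -> (2 ^ s <= n < 2 ^ s.+1)%N ->
     eq_mod_Zp s.+1 (mahler_coef f n) 0).
Proof.
rewrite unif_diff_index1 unif_diff_iff_second_diff //.
rewrite -umbral_ann_second_diff_iff // umbral_ann_sq_iff; last first.
  exact: lipschitz_umbral_ann.
rewrite umbral_ann_subX1_pow2_iff.
by split=> coefs s n s2 /(coefs s n s2);
  rewrite umbral_subX1 /eq_mod_Zp /pow2_dvd subr0.
Qed.
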